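(* Let $1\le p\le2$ be fixed, $r>\eta>0$ and $1\le k<m$. Let $A\in\mathbb{R}^{m\times N}$ have the $(2k,\delta_{2k})$-RIP with $\delta_{2k}<1$, let $\|A\|\le1$, and let $\beta(A)>0$ be such that $$\sup_{i\in\{1,\dots,N\}}|A_i^Tz|\ge\beta(A)\|z\|_{\ell_2}\quad\text{for all } z\in\mathbb{R}^m,$$ where $A_i$ are the columns of $A$. Let $x\in\mathcal{S}^p_{\eta,k,r}$ and let $y=Ax$. Assume $$r>\eta\left(1+\frac{1}{1-\delta_{2k}}\left(1+\frac{1}{\beta(A)}\right)\right),$$ and let $\tau$ be such that $$\eta<\sqrt{\tau}<\frac{r-\frac{\eta}{1-\delta_{2k}}}{1+\frac{1}{(1-\delta_{2k})\beta(A)}}.$$ Let $x^{\mathrm{IHT}}$ be the limit of the iterative hard thresholding iteration $x^{n+1}=\mathbb{H}_{\sqrt{\tau}}\big(x^n+A^T(y-Ax^n)\big)$ (from some starting vector $x^0\in\mathbb{R}^N$), thus fulfilling the fixed point equation $$x^{\mathrm{IHT}}=\mathbb{H}_{\sqrt{\tau}}\big(x^{\mathrm{IHT}}+A^T(y-Ax^{\mathrm{IHT}})\big).$$ Assume further that $$\mathcal{J}_0(x^{\mathrm{IHT}})\le\mathcal{J}_0\big(x|_{S_r(x)}\big).$$ Then $\Lambda:=S_r(x)=\operatorname{supp}(x^{\mathrm{IHT}})$, and $$|x_i-x_i^{\mathrm{IHT}}|<r-\sqrt{\tau}\quad\text{for all } i\in\Lambda.$$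
   Context: Standing assumption: $A\in\mathbb{R}^{m\times N}$ has rank $m$, with $m<N$. $\|A\|$ is the operator norm of $A$ from $\ell_2$ to $\ell_2$. $\operatorname{supp}(z)=\{i: z_i\ne0\}$. $x|_\Lambda$ denotes the vector in $\mathbb{R}^N$ that agrees with $x$ on $\Lambda$ and vanishes off $\Lambda$; $\Lambda^c$ is the complement of $\Lambda$ in $\{1,\dots,N\}$. Restricted Isometry Property: $A$ has the $(K,\delta_K)$-RIP, with $0<\delta_K<1$, if $(1-\delta_K)\|z\|_{\ell_2}\le\|Az\|_{\ell_2}\le(1+\delta_K)\|z\|_{\ell_2}$ for all $z\in\mathbb{R}^N$ with $\#\operatorname{supp}(z)\le K$ (norms are not squared). $S_r(x)=\{i\in\{1,\dots,N\}:|x_i|>r\}$, and $$\mathcal{S}^p_{\eta,k,r}=\Big\{x\in\mathbb{R}^N:\#S_r(x)\le k\ \text{ and }\ \sum_{i\in(S_r(x))^c}|x_i|^p\le\eta^p\Big\}.$$ Hard thresholding: $(\mathbb{H}_{\sqrt{\tau}}(z))_i=z_i$ if $|z_i|>\sqrt{\tau}$ and $(\mathbb{H}_{\sqrt{\tau}}(z))_i=0$ otherwise. $\mathcal{J}_0(z)=\|Az-y\|_{\ell_2}^2+\tau\,\#\operatorname{supp}(z)$ for $z\in\mathbb{R}^N$. *)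

(* Defs.v *)
From HB Require Import structures.
From mathcomp Require Import all_boot all_order all_algebra.
From mathcomp Require Import all_classical all_reals all_analysis.

Set Implicit Arguments.
Unset Strict Implicit.
Unset Printing Implicit Defensive.

Import Order.TTheory GRing.Theory Num.Theory.
Import numFieldNormedType.Exports.

Local Open Scope classical_set_scope.
Local Open Scope ring_scope.

(* MathComp-Analysis puts the max norm on matrices, hence a separate name for
   the Euclidean one. *)
Definition l2norm (R : realType) (n : nat) (z : 'cV[R]_n) : R :=
  Num.sqrt (\sum_(i < n) z i 0 ^+ 2).

Definition opnorm (R : realType) (m N : nat) (A : 'M[R]_(m, N)) : R :=
  sup [set l2norm (A *m z) | z in [set z : 'cV[R]_N | l2norm z <= 1]].

Definition supp (R : realType) (n : nat) (z : 'cV[R]_n) : {set 'I_n} :=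
  [set i | z i 0 != 0]%SET.

Definition coord_restrict (R : realType) (n : nat) (L : {set 'I_n})
    (x : 'cV[R]_n) : 'cV[R]_n :=
  \col_i (if i \in L then x i 0 else 0).

(* The norms are not squared, unlike in the more common definition. *)
Definition RIP (R : realType) (m N : nat) (A : 'M[R]_(m, N)) (K : nat)
    (delta : R) : Prop :=
  0 < delta < 1 /\
  forall z : 'cV[R]_N, (#|supp z| <= K)%N ->
    (1 - delta) * l2norm z <= l2norm (A *m z) <= (1 + delta) * l2norm z.

Definition large_set (R : realType) (n : nat) (r : R) (x : 'cV[R]_n) :
    {set 'I_n} :=
  [set i | r < `|x i 0|]%SET.

Definition sparse_class (R : realType) (n : nat) (p eta : R) (k : nat) (r : R) :
    set 'cV[R]_n :=
  [set x | (#|large_set r x| <= k)%N /\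
           \sum_(i in ~: large_set r x) `|x i 0| `^ p <= eta `^ p].

Definition hard_threshold (R : realType) (n : nat) (t : R) (z : 'cV[R]_n) :
    'cV[R]_n :=
  \col_i (if t < `|z i 0| then z i 0 else 0).

Definition iht_step (R : realType) (m N : nat) (A : 'M[R]_(m, N))
    (y : 'cV[R]_m) (tau : R) (z : 'cV[R]_N) : 'cV[R]_N :=
  hard_threshold (Num.sqrt tau) (z + A^T *m (y - A *m z)).

Definition J0 (R : realType) (m N : nat) (A : 'M[R]_(m, N)) (y : 'cV[R]_m)
    (tau : R) (z : 'cV[R]_N) : R :=
  l2norm (A *m z - y) ^+ 2 + tau * #|supp z|%:R.

(* sup_i |A_i^T z| over the columns A_i; the base value 0 is harmless since
   all the terms are nonnegative. *)
Definition max_corr (R : realType) (m N : nat) (A : 'M[R]_(m, N))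
    (z : 'cV[R]_m) : R :=
  \big[Num.max/0]_(i < N) `|((col i A)^T *m z) 0 0|.

(* Main.v *)
Require Import Defs.
From HB Require Import structures.
From mathcomp Require Import all_boot all_order all_algebra.
From mathcomp Require Import all_classical all_reals all_analysis.
From mathcomp Require Import ring lra.

Set Implicit Arguments.
Unset Strict Implicit.
Unset Printing Implicit Defensive.

Import Order.TTheory GRing.Theory Num.Theory.
Import numFieldNormedType.Exports.

Local Open Scope classical_set_scope.
Local Open Scope ring_scope.

(** Write [S] for [large_set r x], [s] for the square root of [tau], and [z] for
the limit of the iteration. Hard thresholding jumps at [s], so passing to the
limit in the iteration does not at once give the fixed point equation: a
coordinate of [z + A^T (y - A z)] might be approached from outside and land
exactly on the threshold. What does survive in the limit
([iht_limit_stationary]) is that [A^T (y - A z)] vanishes on the support of [z]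
and is at most [s] in absolute value off it. This is enough for the estimates,
and the fixed point equation is recovered from them at the end.

The stationarity condition bounds every correlation of the residual with a
column of [A] by [s], hence [beta * |A z - y| <= s]. On the other side, the
residual of [x] restricted to [S] is the image of the tail of [x]; since [p] is
at most 2 the tail has Euclidean norm at most [eta]
([l2norm_restrict_le_lp]), and [A] is a contraction, so this residual is at most
[eta], which is less than [s]. Comparing the values of [J0] then gives
[tau * #|supp z| < tau * (#|S| + 1)], so [z] has at most [#|S| <= k] nonzero
coordinates, and [z] minus the restriction of [x] is [2k]-sparse. The restricted
isometry property ([l2norm_sub_le_RIP]) turns the two residual bounds into
[(eta + s / beta) / (1 - delta)] as a bound on the Euclidean distance between
them, and the upper bound on [s] says exactly that this is below [r - s].

So on [S], where [x] exceeds [r], the limit [z] exceeds [s] in absolute value.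
Thus [S] is included in the support of [z], and the two are equal by
cardinality. It also follows that no coordinate of [z] has absolute value
exactly [s], which is the only case where the fixed point equation could fail.
*)

(** * The Euclidean norm *)

Lemma l2norm_ge0 (R : realType) n (z : 'cV[R]_n) : 0 <= l2norm z.
Proof. exact: sqrtr_ge0. Qed.

Lemma l2norm_sqr (R : realType) n (z : 'cV[R]_n) :
  l2norm z ^+ 2 = \sum_i z i 0 ^+ 2.
Proof. by rewrite sqr_sqrtr// sumr_ge0// => i _; rewrite sqr_ge0. Qed.

Lemma normr_le_l2norm (R : realType) n (z : 'cV[R]_n) i : `|z i 0| <= l2norm z.
Proof.
rewrite -sqrtr_sqr ler_sqrt ?sumr_ge0// => [|j _]; last exact: sqr_ge0.
by rewrite (bigD1 i)//= lerDl sumr_ge0// => j _; rewrite sqr_ge0.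
Qed.

Lemma l2norm_eq0 (R : realType) n (z : 'cV[R]_n) : l2norm z = 0 -> z = 0.
Proof.
move=> z0; apply/matrixP => i j; rewrite ord1 mxE; apply/eqP.
by rewrite -normr_le0 -z0 normr_le_l2norm.
Qed.

Lemma l2normZ (R : realType) n (c : R) (z : 'cV[R]_n) :
  l2norm (c *: z) = `|c| * l2norm z.
Proof.
apply/eqP; rewrite -(@eqrXn2 _ 2)// ?mulr_ge0 ?l2norm_ge0//.
rewrite exprMn !l2norm_sqr real_normK ?num_real// mulr_sumr.
by apply/eqP/eq_bigr => i _; rewrite mxE exprMn.
Qed.

Lemma l2norm0 (R : realType) n : l2norm (0 : 'cV[R]_n) = 0.
Proof. by rewrite -(scale0r 0) l2normZ normr0 mul0r. Qed.

(** Expand the sum of the squares of the entries of [|v| u - |u| v], which is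
nonnegative; when a norm is zero the vector itself is. *)
Lemma cauchy_schwarz (R : realType) n (u v : 'cV[R]_n) :
  \sum_i u i 0 * v i 0 <= l2norm u * l2norm v.
Proof.
have [/eqP u0|u0] := boolP (l2norm u == 0).
  rewrite u0 mul0r (l2norm_eq0 u0) big1// => i _.
  by rewrite mxE mul0r.
have [/eqP v0|v0] := boolP (l2norm v == 0).
  rewrite v0 mulr0 (l2norm_eq0 v0) big1// => i _.
  by rewrite mxE mulr0.
have u_gt0 : 0 < l2norm u by rewrite lt0r u0 l2norm_ge0.
have v_gt0 : 0 < l2norm v by rewrite lt0r v0 l2norm_ge0.
have : 0 <= \sum_i (l2norm v * u i 0 - l2norm u * v i 0) ^+ 2.
  by apply: sumr_ge0 => i _; rewrite sqr_ge0.
have -> : \sum_i (l2norm v * u i 0 - l2norm u * v i 0) ^+ 2 =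
    2 * (l2norm u * l2norm v) *
      (l2norm u * l2norm v - \sum_i u i 0 * v i 0).
  transitivity (l2norm v ^+ 2 * (\sum_i u i 0 ^+ 2) +
      l2norm u ^+ 2 * (\sum_i v i 0 ^+ 2) -
      2 * (l2norm u * l2norm v) * \sum_i u i 0 * v i 0).
    rewrite !mulr_sumr -big_split -sumrB /=.
    by apply: eq_bigr => i _; ring.
  by rewrite -!l2norm_sqr; ring.
by rewrite pmulr_rge0 ?subr_ge0// !mulr_gt0.
Qed.

Lemma l2normD (R : realType) n (u v : 'cV[R]_n) :
  l2norm (u + v) <= l2norm u + l2norm v.
Proof.
rewrite -(@ler_pXn2r _ 2)// ?nnegrE ?addr_ge0 ?l2norm_ge0//.
rewrite sqrrD !l2norm_sqr.
have -> : \sum_i (u + v) i 0 ^+ 2 =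
    \sum_i u i 0 ^+ 2 + (\sum_i u i 0 * v i 0) *+ 2 + \sum_i v i 0 ^+ 2.
  rewrite -sumrMnl -!big_split /=; apply: eq_bigr => i _.
  by rewrite mxE sqrrD.
by rewrite lerD2r lerD2l lerMn2r cauchy_schwarz orbT.
Qed.

(** [opnorm] is a supremum in the reals, which is an upper bound only for a
bounded set. A crude bound suffices: the entries of [z] are at most 1 when
[l2norm z <= 1]. *)
Lemma has_ubound_opnorm (R : realType) m n (A : 'M[R]_(m, n)) :
  has_ubound [set l2norm (A *m z) | z in [set z : 'cV[R]_n | l2norm z <= 1]].
Proof.
exists (Num.sqrt (\sum_i (\sum_j `|A i j|) ^+ 2)) => _ [z /= z1 <-].
rewrite ler_sqrt ?sumr_ge0// => [|i _]; last exact: sqr_ge0.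
apply: ler_sum => i _; rewrite -(real_normK (num_real _)).
rewrite lerXn2r ?nnegrE ?normr_ge0 ?sumr_ge0// mxE.
rewrite (le_trans (ler_norm_sum _ _ _))//; apply: ler_sum => j _.
by rewrite normrM ler_piMr// (le_trans (normr_le_l2norm z j)).
Qed.

Lemma l2norm_mulmx_le (R : realType) m n (A : 'M[R]_(m, n)) (z : 'cV[R]_n) :
  l2norm (A *m z) <= opnorm A * l2norm z.
Proof.
have [/eqP z0|z0] := boolP (l2norm z == 0).
  by rewrite z0 mulr0 (l2norm_eq0 z0) mulmx0 l2norm0.
have z_gt0 : 0 < l2norm z by rewrite lt0r z0 l2norm_ge0.
rewrite -ler_pdivrMr// mulrC -[(l2norm z)^-1]ger0_norm ?invr_ge0 ?l2norm_ge0//.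
rewrite -l2normZ scalemxAr; apply: (ub_le_sup (has_ubound_opnorm A)).
exists ((l2norm z)^-1 *: z) => //=.
by rewrite l2normZ ger0_norm ?invr_ge0 ?l2norm_ge0// mulVf.
Qed.

(** Each entry on [L] is at most [eta], so for [p <= 2] its square is at most
its [p]-th power times [eta `^ (2 - p)]; then sum over [L]. *)
Lemma l2norm_restrict_le_lp (R : realType) n (p eta : R) (L : {set 'I_n})
    (x : 'cV[R]_n) :
  0 < p <= 2 -> 0 <= eta -> \sum_(i in L) `|x i 0| `^ p <= eta `^ p ->
  l2norm (coord_restrict L x) <= eta.
Proof.
move=> /andP[p0 p2] eta0 le_lp.
have le_eta i : i \in L -> `|x i 0| <= eta.
  move=> iL; rewrite leNgt; apply/negP => lt_eta.
  have := gt0_ltr_powR p0 eta0 (normr_ge0 (x i 0)) lt_eta.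
  apply/negP; rewrite -leNgt (le_trans _ le_lp)// (bigD1 i)//=.
  by rewrite lerDl sumr_ge0// => j _; rewrite powR_ge0.
have sqrE (a : R) : 0 <= a -> a ^+ 2 = a `^ p * a `^ (2 - p).
  move=> a0; rewrite -powRD; last by rewrite addrC subrK pnatr_eq0.
  by rewrite addrC subrK -[2]/(2%:R) powR_mulrn.
rewrite -(@ler_pXn2r _ 2)// ?nnegrE ?l2norm_ge0// l2norm_sqr sqrE//.
apply: (le_trans (y := (\sum_(i in L) `|x i 0| `^ p) * eta `^ (2 - p))); last first.
  by rewrite ler_wpM2r ?powR_ge0.
rewrite mulr_suml [leRHS]big_mkcond /=; apply: ler_sum => i _.
rewrite mxE; case: ifPn => [iL|_]; last by rewrite expr0n.
rewrite -(real_normK (num_real _)) sqrE// ler_wpM2l ?powR_ge0//.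
by apply: ge0_ler_powR; rewrite ?subr_ge0 ?nnegrE ?le_eta.
Qed.

(** * Supports *)

Lemma coord_restrict_splitC (R : realType) n (L : {set 'I_n}) (x : 'cV[R]_n) :
  x = coord_restrict L x + coord_restrict (~: L) x.
Proof.
apply/matrixP => i j; rewrite ord1 !mxE inE.
by case: (i \in L); rewrite /= ?addr0 ?add0r.
Qed.

Lemma supp_coord_restrict (R : realType) n (L : {set 'I_n}) (x : 'cV[R]_n) :
  supp (coord_restrict L x) \subset L.
Proof.
by apply/fintype.subsetP => i; rewrite inE mxE; case: (i \in L); rewrite ?eqxx.
Qed.

Lemma card_suppB (R : realType) n (u v : 'cV[R]_n) :
  (#|supp (u - v)%R| <= #|supp u| + #|supp v|)%N.
Proof.
rewrite (leq_trans _ (leq_card_setU _ _))// subset_leq_card//.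
apply/fintype.subsetP => i; rewrite !inE !mxE -negb_and; apply: contra.
by move=> /andP[/eqP-> /eqP->]; rewrite subr0.
Qed.

(** The lower half of the isometry property bounds the difference of two
sparse vectors by that of their images; hence two sparse vectors that explain
the same data [y] well are close. *)
Lemma l2norm_sub_le_RIP (R : realType) m n (A : 'M[R]_(m, n)) K (delta : R)
    (y : 'cV[R]_m) (u v : 'cV[R]_n) :
  RIP A K delta -> (#|supp u| + #|supp v| <= K)%N ->
  l2norm (u - v) <= (l2norm (A *m u - y) + l2norm (A *m v - y)) / (1 - delta).
Proof.
move=> [/andP[_ d1] hRIP] cardK.
rewrite ler_pdivlMr ?subr_gt0// mulrC.
have /andP[+ _] := hRIP (u - v) (leq_trans (card_suppB u v) cardK).
move=> /le_trans; apply.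
have -> : A *m (u - v) = (A *m u - y) + (-1) *: (A *m v - y).
  by rewrite mulmxBr scaleN1r opprB addrA subrK.
by rewrite (le_trans (l2normD _ _))// l2normZ normrN1 mul1r.
Qed.

(** * Limits of thresholded sequences *)

(** If [a] is nonzero then [f] is eventually nonzero, hence eventually equal to
the unthresholded [g]; if [`|b| > s] then thresholding is eventually inactive
as well. When [`|b| = s] both [a = b] and [a = 0] can occur, the former if [g]
approaches [b] from outside. *)
Lemma cvg_hard_threshold (R : realType) (s a b : R) (f g : R^nat) :
  0 <= s -> f @ \oo --> a -> g @ \oo --> b ->
  (forall n, f n.+1 = if s < `|g n| then g n else 0) ->
  (a != 0 -> b = a) /\ (a = 0 -> `|b| <= s).
Proof.
move=> s0 fa gb fg.
have fSa : (fun n => f n.+1) @ \oo --> a by rewrite (cvg_shiftS f).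
have lim_eq : (\forall n \near \oo, f n.+1 = g n) -> b = a.
  move=> eq_fg; apply: (@cvg_unique _ (@Rhausdorff R) (g @ \oo)) => //.
  apply: cvg_trans fSa; apply: near_eq_cvg.
  exact: eq_fg.
split=> [a0|a0].
  apply: lim_eq; near=> n.
  have : f n.+1 != 0 by near: n; exact: cvgr_neq0 fSa a0.
  by rewrite fg; case: ifP; rewrite ?eqxx.
rewrite leNgt; apply/negP => sb.
have : b = 0.
  rewrite -a0; apply: lim_eq; near=> n; rewrite fg ifT//.
  by near: n; apply: cvgr_gt sb; apply: cvg_norm.
by move=> b0; move: sb; rewrite b0 normr0 ltNge s0.
Unshelve. all: by end_near. Qed.

Lemma cvg_mulmx_coord (R : realType) m n (M : 'M[R]_(m, n))
    (u : nat -> 'cV[R]_n) (l : 'cV[R]_n) i :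
  (forall j, u k j 0 @[k --> \oo] --> l j 0) ->
  (M *m u k) i 0 @[k --> \oo] --> (M *m l) i 0.
Proof.
move=> ul; rewrite mxE; under eq_fun do rewrite mxE.
by apply: cvg_big => [|j _]; [exact: add_continuous|exact: cvgMl_tmp].
Qed.

(** This is weaker than the fixed point equation: it records nothing about the
size of the nonzero coordinates of [z], because one whose absolute value is
exactly the square root of [tau] is not preserved by the strict threshold. *)
Lemma iht_limit_stationary (R : realType) m N (A : 'M[R]_(m, N))
    (y : 'cV[R]_m) (tau : R) (u : nat -> 'cV[R]_N) (z : 'cV[R]_N) :
  (forall n, u n.+1 = iht_step A y tau (u n)) -> u n @[n --> \oo] --> z ->
  forall i, (z i 0 != 0 -> (A^T *m (y - A *m z)) i 0 = 0) /\
            (z i 0 = 0 -> `|(A^T *m (y - A *m z)) i 0| <= Num.sqrt tau).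
Proof.
move=> hu uz i.
have uzj j : u n j 0 @[n --> \oo] --> z j 0.
  exact: (cvg_comp _ (fun w : 'cV[R]_N => w j 0) uz (@coord_continuous _ _ _ j 0 z)).
have gz : (u n + A^T *m (y - A *m u n)) i 0 @[n --> \oo] -->
    (z + A^T *m (y - A *m z)) i 0.
  (* As a function of the iterate, the argument of the threshold is affine. *)
  have E w : (w + A^T *m (y - A *m w)) i 0 =
      w i 0 + ((A^T *m y) i 0 - ((A^T *m A) *m w) i 0).
    by rewrite mulmxBr mulmxA !mxE.
  rewrite E; under eq_fun do rewrite E.
  apply: cvgD => //; apply: cvgB; first exact: cvg_cst.
  exact: cvg_mulmx_coord.
have [|zN0 z0] := cvg_hard_threshold (sqrtr_ge0 tau) (uzj i) gz.
  by move=> n; rewrite hu mxE.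
split=> [/zN0|zi0].
  by rewrite [(z + _) _ _]mxE => /eqP; rewrite -subr_eq0 addrAC subrr add0r => /eqP.
by move: (z0 zi0); rewrite mxE zi0 add0r.
Qed.

Lemma max_corr_le (R : realType) m N (A : 'M[R]_(m, N))
    (w : 'cV[R]_m) (c : R) :
  0 <= c -> (forall i, `|(A^T *m w) i 0| <= c) -> max_corr A w <= c.
Proof.
move=> c0 le_c; apply: bigmax_le => // i _.
by have -> : ((col i A)^T *m w) 0 0 = (A^T *m w) i 0 by rewrite tr_col -row_mul mxE.
Qed.

(** * Support recovery *)

Theorem theorem5 (R : realType) (m N : nat) (A : 'M[R]_(m, N))
    (hmN : (m < N)%N) (hrank : \rank A = m)
    (p : R) (hp : 1 <= p <= 2)
    (r eta : R) (heta : 0 < eta) (hr : eta < r)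
    (k : nat) (hk : (1 <= k < m)%N)
    (delta : R) (hRIP : RIP A (2 * k)%N delta)
    (hA : opnorm A <= 1)
    (beta : R) (hbeta : 0 < beta)
    (hcorr : forall z : 'cV[R]_m, beta * l2norm z <= max_corr A z)
    (x : 'cV[R]_N) (hx : sparse_class p eta k r x)
    (y : 'cV[R]_m) (hy : y = A *m x)
    (hgap : eta * (1 + 1 / (1 - delta) * (1 + 1 / beta)) < r)
    (tau : R)
    (htau : eta < Num.sqrt tau <
            (r - eta / (1 - delta)) / (1 + 1 / ((1 - delta) * beta)))
    (u : nat -> 'cV[R]_N)
    (hu : forall n : nat, u n.+1 = iht_step A y tau (u n))
    (xIHT : 'cV[R]_N) (hlim : u n @[n --> \oo] --> xIHT)
    (hJ : J0 A y tau xIHT <= J0 A y tau (coord_restrict (large_set r x) x)) :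
  xIHT = iht_step A y tau xIHT /\
  large_set r x = supp xIHT /\
  (forall i : 'I_N, i \in large_set r x ->
     `|x i 0 - xIHT i 0| < r - Num.sqrt tau).
Proof.
set S := large_set r x; set s := Num.sqrt tau.
have [hd _] := hRIP; have /andP[d0 d1] := hd.
have /andP[eta_s s_lt] := htau.
have s0 : 0 < s by exact: lt_trans eta_s.
have tau0 : 0 < tau by rewrite -sqrtr_gt0.
have tauE : tau = s ^+ 2 by rewrite sqr_sqrtr// ltW.
have [/= cardS lpS] := hx.
have stat := iht_limit_stationary hu hlim.
have res_s : l2norm (A *m xIHT - y) <= s / beta.
  rewrite ler_pdivlMr// mulrC -opprB -scaleN1r l2normZ normrN1 mul1r.
  rewrite (le_trans (hcorr _))//; apply: max_corr_le; first exact: ltW.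
  move=> i; have [statN0 stat0] := stat i.
  have [/stat0//|/statN0->] := eqVneq (xIHT i 0) 0.
  by rewrite normr0 ltW.
have res_eta : l2norm (A *m coord_restrict S x - y) <= eta.
  have -> : A *m coord_restrict S x - y = (-1) *: (A *m coord_restrict (~: S) x).
    rewrite hy [in A *m x](coord_restrict_splitC S x) mulmxDr scaleN1r.
    by rewrite opprD addrA subrr add0r.
  rewrite l2normZ normrN1 mul1r (le_trans (l2norm_mulmx_le _ _))//.
  apply: (@le_trans _ _ (l2norm (coord_restrict (~: S) x))).
    by rewrite ler_piMl// l2norm_ge0.
  apply: (l2norm_restrict_le_lp (p := p)) => //; last exact: ltW.
  by case/andP: hp => p1 ->; rewrite (lt_le_trans _ p1).
have card_le : (#|supp xIHT| <= #|S|)%N.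
  (* The residual of the restriction costs less than one unit [tau] of sparsity. *)
  rewrite -ltnS -(ltr_nat R) -(ltr_pM2l tau0).
  apply: (@le_lt_trans _ _ (J0 A y tau xIHT)).
    by rewrite /J0 lerDr sqr_ge0.
  apply: (le_lt_trans hJ); rewrite -natr1 mulrDr mulr1 addrC /J0.
  apply: ltr_leD.
    by rewrite tauE ltrXn2r// ?nnegrE ?l2norm_ge0 ?(ltW s0) ?(le_lt_trans res_eta).
  by rewrite ler_pM2l// ler_nat subset_leq_card// supp_coord_restrict.
have err : l2norm (coord_restrict S x - xIHT) < r - s.
  have card2k : (#|supp (coord_restrict S x)| + #|supp xIHT| <= 2 * k)%N.
    rewrite mul2n -addnn leq_add//; last exact: leq_trans cardS.
    by rewrite (leq_trans _ cardS)// subset_leq_card// supp_coord_restrict.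
  apply: (le_lt_trans (l2norm_sub_le_RIP y hRIP card2k)).
  apply: (@le_lt_trans _ _ ((eta + s / beta) / (1 - delta))).
    by rewrite ler_pM2r ?invr_gt0 ?subr_gt0// lerD.
  have d1' : 0 < 1 - delta by rewrite subr_gt0.
  move: s_lt; rewrite ltr_pdivlMr; last first.
    by rewrite addr_gt0// divr_gt0// mulr_gt0.
  have -> : s * (1 + 1 / ((1 - delta) * beta)) = s + s / beta / (1 - delta).
    by field; rewrite !gt_eqF.
  rewrite mulrDl; lra.
have errS i : i \in S -> `|x i 0 - xIHT i 0| < r - s.
  move=> iS; apply: le_lt_trans err.
  rewrite (le_trans _ (normr_le_l2norm _ i))//.
  by rewrite !mxE iS.
have bigS i : i \in S -> s < `|xIHT i 0|.
  move=> iS; have := errS i iS.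
  have rx : r < `|x i 0| by move: iS; rewrite inE.
  have := lerB_dist (x i 0) (xIHT i 0); lra.
have suppE : S = supp xIHT.
  apply/eqP; rewrite eqEcard card_le andbT; apply/fintype.subsetP => i iS.
  by rewrite inE -normr_gt0 (lt_trans s0)// bigS.
split; last by split.
(* On the support, [bigS] excludes the value [s], so the strict threshold keeps
   the coordinate. *)
apply/matrixP => i j; rewrite ord1 mxE mxE.
have [statN0 stat0] := stat i.
have [zi0|zi0] := eqVneq (xIHT i 0) 0.
  by rewrite zi0 add0r ltNge stat0.
by rewrite statN0// addr0 bigS// suppE inE.
Qed.
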